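(* Let $(G,o)$ be a Menger algebra of rank $n$ and let $H\subseteq G$ be a subset. The following conditions are equivalent: (i) $H$ is bistrong. (ii) For all $g_1,g_2\in G$, $\overline{x},\overline{y}\in B$ and $t_1,t_2\in T_n(G)$: if $t_1(g_1[\overline{x}])\in H$, $t_1(g_2[\overline{x}])\in H$ and $t_2(g_2[\overline{y}])\in H$, then $t_2(g_1[\overline{y}])\in H$. (iii) For all $\overline{x},\overline{y}\in B$ and $t_1,t_2\in T_n(G)$: if $\sigma^{\circ}_H\langle\overline{x},t_1\rangle\cap\sigma^{\circ}_H\langle\overline{y},t_2\rangle\neq\varnothing$, then $\sigma^{\circ}_H\langle\overline{x},t_1\rangle=\sigma^{\circ}_H\langle\overline{y},t_2\rangle$.
   Context: Let $n$ be a positive integer. A Menger algebra $(G,o)$ of rank $n$ is a nonempty set $G$ with an $(n+1)$-ary operation $o:(f,g_1,\ldots,g_n)\mapsto f[g_1\ldots g_n]$ satisfying the superassociative law $f[g_1\ldots g_n][h_1\ldots h_n]=f[g_1[h_1\ldots h_n]\ldots g_n[h_1\ldots h_n]]$ for all $f,g_i,h_i\in G$. Put $B=G^n\cup\{\overline{e}\}$, where $\overline{e}=(e_1,\ldots,e_n)$ is a tuple of pairwise different formal symbols not in $G$. For $g\in G$ and $\overline{x}=(x_1,\ldots,x_n)\in G^n$ write $g[\overline{x}]=g[x_1\ldots x_n]$, and put $g[\overline{e}]=g$. $T_n(G)$ is the smallest set of polynomials in one variable $x$ such that $x\in T_n(G)$ and, whenever $i\in\{1,\ldots,n\}$, $a,b_1,\ldots,b_{i-1},b_{i+1},\ldots,b_n\in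 G$ and $t\in T_n(G)$, also $a[b_1\ldots b_{i-1}\,t\,b_{i+1}\ldots b_n]\in T_n(G)$. Each $t\in T_n(G)$ is identified with the map $G\to G$, $x\mapsto t(x)$, it defines. For $H\subseteq G$, $g\in G$, $(\overline{x},t)\in B\times T_n(G)$ put $\sigma_H\langle g\rangle=\{(\overline{x},t)\in B\times T_n(G)\mid t(g[\overline{x}])\in H\}$ and $\sigma^{\circ}_H\langle\overline{x},t\rangle=\{g\in G\mid t(g[\overline{x}])\in H\}$. The subset $H$ is called bistrong if for all $a,b\in G$, $\sigma_H\langle a\rangle\cap\sigma_H\langle b\rangle\neq\varnothing$ implies $\sigma_H\langle a\rangle=\sigma_H\langle b\rangle$. *)

(* Defs.v *)
From mathcomp Require Import all_boot.
From mathcomp Require Import boolp classical_sets.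

Set Implicit Arguments.
Unset Strict Implicit.
Unset Printing Implicit Defensive.

Local Open Scope classical_set_scope.

(* [mcomp f [tuple g_1; ...; g_n]] is f[g_1 ... g_n].  Positivity of the rank
   is left to the statements that use the structure. *)
Record mengerAlgebra (n : nat) := MengerAlgebra {
  carrier :> Type;
  mcomp : carrier -> n.-tuple carrier -> carrier;
  carrier_inhabited : inhabited carrier;
  superassociative : forall (f : carrier) (g h : n.-tuple carrier),
    mcomp (mcomp f g) h = mcomp f [tuple of [seq mcomp gi h | gi <- g]]
}.

Section Menger.
Variables (n : nat) (G : mengerAlgebra n).

(* B = G^n together with the formal tuple of selectors, encoded by [None]. *)
Definition extTuple : Type := option (n.-tuple G).

Definition subst (g : G) (x : extTuple) : G :=
  if x is Some u then mcomp g u else g.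

(* T_n(G), polynomials being identified with the maps they define.  The value
   [b i] is ignored, so [b] stands for (b_j)_{j != i}. *)
Inductive Tn : set (G -> G) :=
| Tn_var : Tn (fun x => x)
| Tn_comp (i : 'I_n) (a : G) (b : 'I_n -> G) (t : G -> G) :
    Tn t ->
    Tn (fun x => mcomp a [tuple (if j == i then t x else b j) | j < n]).

Definition sigma (H : set G) (g : G) : set (extTuple * (G -> G)) :=
  [set p | Tn p.2 /\ H (p.2 (subst g p.1))].

Definition sigmao (H : set G) (x : extTuple) (t : G -> G) : set G :=
  [set g | H (t (subst g x))].

Definition bistrong (H : set G) : Prop :=
  forall a b : G,
    sigma H a `&` sigma H b !=set0 -> sigma H a = sigma H b.

End Menger.

(* Main.v *)
Require Import Defs.
From mathcomp Require Import all_boot.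
From mathcomp Require Import boolp classical_sets.

Set Implicit Arguments.
Unset Strict Implicit.
Unset Printing Implicit Defensive.

Local Open Scope classical_set_scope.

(** Relate [g] to a pair [(x, t)] when [t (subst g x)] lies in [H]. Then [sigma] gives the rows of
    this relation and [sigmao] its columns. Rows that meet coincide exactly when three corners of a
    rectangle force the fourth, which is [cond_ii]; that condition is symmetric in rows and columns,
    so it equally says that columns that meet coincide. *)

Theorem theorem4p4 (n : nat) (n_gt0 : (0 < n)%N) (G : mengerAlgebra n)
    (H : set G) :
  let cond_ii :=
    forall (g1 g2 : G) (x y : extTuple G) (t1 t2 : G -> G),
      Tn t1 -> Tn t2 ->
      H (t1 (subst g1 x)) -> H (t1 (subst g2 x)) -> H (t2 (subst g2 y)) ->
      H (t2 (subst g1 y)) in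
  let cond_iii :=
    forall (x y : extTuple G) (t1 t2 : G -> G),
      Tn t1 -> Tn t2 ->
      sigmao H x t1 `&` sigmao H y t2 !=set0 ->
      sigmao H x t1 = sigmao H y t2 in
  (bistrong H <-> cond_ii) /\ (cond_ii <-> cond_iii).
Proof.
move=> cond_ii cond_iii; split; split.
- move=> bsH g1 g2 x y t1 t2 Tt1 Tt2 H1 H2 H3.
  have e : sigma H g1 = sigma H g2 by apply: bsH; exists (x, t1).
  have : sigma H g2 (y, t2) by [].
  by rewrite -e => -[].
- move=> ii a b [[x t1] [[/= Tt1 Ha] [_ /= Hb]]].
  (* The shared pair [(x, t1)] supplies two corners for both inclusions; only the roles of [a] and
     [b] swap. *)
  apply/seteqP; split=> -[y t2] [/= Tt2 Ht2]; split=> //=.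
    exact: (ii b a x y t1 t2).
  exact: (ii a b x y t1 t2).
- move=> ii x y t1 t2 Tt1 Tt2 [g0 [H1 H2]].
  apply/seteqP; split=> g Hg.
    exact: (ii g g0 x y t1 t2).
  exact: (ii g g0 y x t2 t1).
- move=> iii g1 g2 x y t1 t2 Tt1 Tt2 H1 H2 H3.
  (* [g2] lies in both columns by [H2] and [H3]; [H1] then carries [g1] across. *)
  have e : sigmao H x t1 = sigmao H y t2 by apply: iii => //; exists g2.
  have : sigmao H x t1 g1 by [].
  by rewrite e.
Qed.
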